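(* Let $E$ be a normed vector space over $\mathbb K$ ($\mathbb R$ or $\mathbb C$) and $\mathbf y\in E'$ a continuous linear functional on $E$. Consider sequences $(\mathbf S_n)$ in $E$ of the form $$\text{a)}\ \ \mathbf S_n-\mathbf S\sim\sum_{i=1}^\infty a_i\lambda_i^n\mathbf u_i\quad(n\to\infty),\qquad\text{or}\qquad \text{b)}\ \ \mathbf S_n-\mathbf S\sim(-1)^n\sum_{i=1}^\infty a_i\lambda_i^n\mathbf u_i\quad(n\to\infty),$$ where $a_i,\lambda_i\in\mathbb K$, $\mathbf u_i\in E$, and $1>\lambda_1>\lambda_2>\cdots>0$. Let $\boldsymbol{\widehat\varepsilon}_{2k}^{(n)}$ be the first topological Shanks transforms of $(\mathbf S_n)$ with respect to $\mathbf y$. Then, when $k$ is fixed and $n$ tends to infinity, $$\boldsymbol{\widehat\varepsilon}_{2k}^{(n)}-\mathbf S=\mathcal O(\lambda_{k+1}^n),\qquad \frac{\|\boldsymbol{\widehat\varepsilon}_{2k+2}^{(n)}-\mathbf S\|}{\|\boldsymbol{\widehat\varepsilon}_{2k}^{(n)}-\mathbf S\|}=\mathcal O\big((\lambda_{k+2}/\lambda_{k+1})^n\big).$$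
   Context: First topological Shanks transforms: with $\Delta\mathbf S_n=\mathbf S_{n+1}-\mathbf S_n$, for $k,n\ge 0$ let $a_0^{(n,k)},\ldots,a_k^{(n,k)}\in\mathbb K$ be the solution of $\sum_{i=0}^k a_i^{(n,k)}=1$ and $\sum_{i=0}^k a_i^{(n,k)}\langle\mathbf y,\Delta\mathbf S_{n+j+i}\rangle=0$ for $j=0,\ldots,k-1$. Then $\boldsymbol{\widehat\varepsilon}_{2k}^{(n)}=a_0^{(n,k)}\mathbf S_n+\cdots+a_k^{(n,k)}\mathbf S_{n+k}$. (The coefficients $a_i^{(n,k)}$ are unrelated to the $a_i$ of the expansion.) The symbol $\sim$ followed by an infinite series denotes an asymptotic expansion as $n\to\infty$: for each $p\ge1$, the difference between the left-hand side and the sum of the first $p$ terms is $o(\lambda_p^n)$ in norm. All quantities involved are assumed to be defined (the linear systems are uniquely solvable, at least for $n$ large, and the denominators are nonzero).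
   Formalization: The formal theorem additionally assumes a_i⟨y,u_i⟩ ≠ 0 for 1 ≤ i ≤ k+1; without it the claim fails, e.g. in K² with y the second coordinate, u_1=e_1, u_i=e_2 (i≥2), a_i=1, λ_i=2^{-i}, k=1, where the error has exact order λ_1^n. *)

(* Defs.v *)
(* MathComp / MathComp-Analysis *)
From HB Require Import structures.
From mathcomp Require Import all_boot all_order all_algebra.
From mathcomp Require Import all_classical all_reals all_analysis.
From mathcomp Require Import complex.
Import Order.TTheory GRing.Theory Num.Theory.
Import numFieldNormedType.Exports.

Set Implicit Arguments.
Unset Strict Implicit.
Unset Printing Implicit Defensive.

Local Open Scope classical_set_scope.
Local Open Scope ring_scope.

(* On R[i] the order is the partial one: x < y means that y - x is a positive
   real, so [0 < x < 1] in K makes x real in both cases. *)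
Definition real_or_complex (R : realType) (K : numFieldType) : Prop :=
  K = R :> numFieldType \/ K = R[i] :> numFieldType.

Section TopologicalShanks.
Variables (K : numFieldType) (E : normedModType K).
Implicit Types (y : {linear E -> K^o}) (S : nat -> E) (k n : nat).

Definition fwd_diff S n : E := S n.+1 - S n.

Definition shanks_system y S k n (c : {ffun 'I_k.+1 -> K}) : Prop :=
  \sum_i c i = 1 /\
  forall j : 'I_k, \sum_i c i * y (fwd_diff S (n + j + i)%N) = 0.

Definition shanks_solvable y S k n : Prop := exists! c, @shanks_system y S k n c.

(* All coefficients are 0 (a dummy value) when the system has no solution. *)
Definition shanks_coef y S k n : {ffun 'I_k.+1 -> K} :=
  xget [ffun=> 0] [set c | @shanks_system y S k n c].

(* The first topological Shanks transform $\hat\varepsilon_{2k}^{(n)}$: the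
   argument k is half of the lower index. *)
Definition shanks1 y S k n : E :=
  \sum_(i < k.+1) shanks_coef y S k n i *: S (n + i)%N.

(* Sum of the first p terms of the series; indices are shifted by one with
   respect to the usual numbering, i.e. [a i] stands for $a_{i+1}$, and
   likewise for lam and u. *)
Definition exp_sum (a lam : nat -> K) (u : nat -> E) (p n : nat) : E :=
  \sum_(i < p) (a i * lam i ^+ n) *: u i.

End TopologicalShanks.

(* Main.v *)
(* Let P_n(X) = sum_i c_i X^i be the polynomial of the Shanks coefficients, so
   that P_n(1) = 1. The system says that w_j = sum_i c_i <y, S_(n+j+i) - S> does
   not depend on j <= k; inserting the expansion with nodes mu_m, this gives
     Q(1) w_0 = sum_(m <= k) b_m mu_m^n P_n(mu_m) Q(mu_m) + small
   for every polynomial Q of degree <= k, where b_m = a_m <y, u_m>. Taking for Q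
   the Lagrange polynomials of the nodes 1, mu_0, ..., mu_(k-1) yields
   P_n(mu_m) = O((mu_k / mu_m)^n) for m < k, and then, by interpolation, that the
   coefficients of P_n are bounded and P_n(mu_k) tends to the nonzero value L at
   mu_k of the Lagrange polynomial of the node 1. Hence the error is O(mu_k^n),
   and since w_0 ~ b_k L^2 mu_k^n it is also bounded below by a multiple of
   |mu_k|^n; the ratio estimate follows. *)
Require Import Defs.
From HB Require Import structures.
From mathcomp Require Import all_boot all_order all_algebra.
From mathcomp Require Import all_classical all_reals all_analysis.
From mathcomp Require Import complex.
From mathcomp Require Import ring.
Import Order.TTheory GRing.Theory Num.Theory.
Import numFieldNormedType.Exports.
Local Open Scope classical_set_scope.
Local Open Scope ring_scope.

(** * Geometric decay and Lagrange interpolation over K *)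

Lemma real_or_complex_bound (R : realType) (K : numFieldType) (x : K) :
  real_or_complex R K -> 0 <= x -> exists n : nat, x < n%:R.
Proof.
move=> hK; case: hK x => -> x x0.
  by exists (Num.bound x); exact: archi_boundP.
(* A nonnegative element of [R[i]] is real, so the Archimedean property of [R] applies to its real
   part. *)
have xr : x \is Num.real by rewrite ger0_real.
exists (Num.bound (complex.Re x)).
rewrite -(RRe_real xr) -(rmorph_nat (real_complex R)) ltcR.
by rewrite archi_boundP // -lecR RRe_real.
Qed.

Lemma bernoulli_le (K : numDomainType) (h : K) n :
  0 <= h -> n%:R * h <= (1 + h) ^+ n.
Proof.
move=> h0; suff: 1 + n%:R * h <= (1 + h) ^+ n.
  by apply: le_trans; rewrite lerDr ler01.
elim: n => [|n IHn]; first by rewrite mul0r addr0 expr0.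
rewrite exprS; apply: le_trans (ler_wpM2l _ IHn); last by rewrite addr_ge0.
rewrite mulrDl mul1r mulrDr mulr1 -natr1 mulrDl mul1r addrA lerD2l.
by rewrite lerDl !mulr_ge0.
Qed.

(** For x > 0, Bernoulli's inequality gives n (1/x - 1) <= (1/x)^n, and by the Archimedean property
    the left side eventually exceeds 1/eps. *)
Lemma near_expr_le (R : realType) (K : numFieldType) (x eps : K) :
  real_or_complex R K -> 0 <= x -> x < 1 -> 0 < eps ->
  \forall n \near \oo, x ^+ n <= eps.
Proof.
move=> hK x0 x1 eps0.
have [->|xn0] := eqVneq x 0.
  (* The rank starts at 1 because [0 ^+ 0] is 1. *)
  by exists 1%N => // n /= n0; rewrite expr0n gtn_eqF // ltW.
have {x0 xn0} x0 : 0 < x by rewrite lt_neqAle eq_sym xn0.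
have h0 : 0 < x^-1 - 1 by rewrite subr_gt0 invf_gt1.
have hi0 : 0 < (x^-1 - 1)^-1 by rewrite invr_gt0.
have [N hN] := @real_or_complex_bound R K ((x^-1 - 1)^-1 / eps) hK
  (divr_ge0 (ltW hi0) (ltW eps0)).
exists N => // n /= Nn.
have : n%:R * (x^-1 - 1) <= x^-1 ^+ n.
  by have := @bernoulli_le K _ n (ltW h0); rewrite [1 + _]addrC subrK.
move=> hb; rewrite -[_ ^+ _]invrK -exprVn -[eps]invrK.
rewrite lef_pV2 ?posrE ?invr_gt0 ?exprn_gt0 ?invr_gt0 //.
apply: le_trans hb; rewrite -ler_pdivrMr // mulrC.
by apply: le_trans (ltW hN) _; rewrite ler_nat.
Qed.

Lemma lagrange_basis (K : fieldType) (k : nat) (x : nat -> K) :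
  injective x -> exists l : 'I_k.+1 -> {poly K},
  [/\ forall i, (size (l i) <= k.+1)%N,
      forall i j : 'I_k.+1, (l i).[x j] = (i == j)%:R &
      forall p : {poly K}, (size p <= k.+1)%N -> p = \sum_(i < k.+1) p.[x i] *: l i].
Proof.
move=> x_inj; exists (fun i => tnth (qpoly.lagrange k.+1 x) i); split.
- by move=> i; rewrite qpoly.size_lagrange_.
- exact: qpoly.lagrange_sample.
- move=> p /(qpoly.lagrange_gen (ltn0Sn k) x_inj) {1}->.
  by apply: eq_bigr => i _; rewrite mul_polyC.
Qed.

(** * Algebra of the Shanks system at a fixed n *)

Section ShanksSystem.
Variables (K : numFieldType) (E : normedModType K).
Implicit Types (y : {linear E -> K^o}) (S : nat -> E) (k n : nat).

Definition shanks_poly k (c : {ffun 'I_k.+1 -> K}) : {poly K} :=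
  \poly_(i < k.+1) c (inord i).

Lemma coef_shanks_poly k (c : {ffun 'I_k.+1 -> K}) (i : 'I_k.+1) :
  (shanks_poly k c)`_i = c i.
Proof. by rewrite coef_poly ltn_ord inord_val. Qed.

Lemma horner_shanks_poly k (c : {ffun 'I_k.+1 -> K}) z :
  (shanks_poly k c).[z] = \sum_i c i * z ^+ i.
Proof. by rewrite horner_poly; apply: eq_bigr => i _; rewrite inord_val. Qed.

Lemma shanks_coefP y S k n :
  shanks_solvable y S k n -> shanks_system y S n (shanks_coef y S k n).
Proof. by case=> c [hc _]; apply: (xgetPex _ (ex_intro _ c hc)). Qed.

Lemma shanks1_subE y S k n (z : E) : shanks_solvable y S k n ->
  shanks1 y S k n - z =
  \sum_(i < k.+1) shanks_coef y S k n i *: (S (n + i)%N - z).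
Proof.
move=> /shanks_coefP[h1 _]; under [RHS]eq_bigr do rewrite scalerBr.
by rewrite sumrB -scaler_suml h1 scale1r.
Qed.

(** Row j of the system is the difference of the sums at the shifts j+1 and j, so its k rows equate
    the k+1 sums for j <= k. *)
Lemma shanks_system_const y S k n (z : E) (c : {ffun 'I_k.+1 -> K}) :
  shanks_system y S n c -> forall j, (j <= k)%N ->
  \sum_i c i * y (S (n + j + i)%N - z) = \sum_i c i * y (S (n + i)%N - z).
Proof.
move=> [_ h]; elim=> [|j IHj] jk; first by rewrite addn0.
rewrite -(IHj (ltnW jk)); apply/eqP; rewrite -subr_eq0 -sumrB.
rewrite -[X in _ == X](h (Ordinal jk)); apply/eqP/eq_bigr => i _ /=.
by rewrite -mulrBr -linearB /fwd_diff addnS addSn opprB addrA subrK.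
Qed.

(** Shifting a geometric sequence by i multiplies it by [mu m ^+ i], so the combination acts on the
    m-th term as the factor P(mu_m). *)
Lemma exp_sumM (a mu : nat -> K) (u : nat -> E) p k n (c : {ffun 'I_k.+1 -> K}) :
  \sum_i c i *: exp_sum a mu u p (n + i) =
  \sum_(m < p) (a m * mu m ^+ n * (shanks_poly k c).[mu m]) *: u m.
Proof.
rewrite /exp_sum; under eq_bigr do rewrite scaler_sumr.
rewrite exchange_big; apply: eq_bigr => m _ /=.
rewrite horner_shanks_poly mulr_sumr scaler_suml; apply: eq_bigr => i _.
by rewrite scalerA exprD; congr (_ *: _); ring.
Qed.

(* Both sides are the value at [Q] of the linear functional sending ['X^j] to
   the [j]-th shifted combination, which the system makes independent of [j]. *)
Lemma shanks_moment y S k n (z : E) (a mu : nat -> K) (u : nat -> E)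
    (c : {ffun 'I_k.+1 -> K}) (Q : {poly K}) :
  let r n := S n - z - exp_sum a mu u k.+1 n in
  shanks_system y S n c -> (size Q <= k.+1)%N ->
  Q.[1] * y (\sum_i c i *: (S (n + i)%N - z)) =
  \sum_(m < k.+1) a m * y (u m) * mu m ^+ n * (shanks_poly k c).[mu m] * Q.[mu m]
  + \sum_(j < k.+1) \sum_i Q`_j * (c i * y (r (n + j + i)%N)).
Proof.
move=> r hc sQ; set w := y _.
have hw (j : 'I_k.+1) : w = y (\sum_i c i *: exp_sum a mu u k.+1 (n + j + i))
    + \sum_i c i * y (r (n + j + i)%N).
  have jk : (j <= k)%N by rewrite -ltnS.
  rewrite /w !linear_sum /=; under eq_bigr do rewrite linearZ /=.
  rewrite -(shanks_system_const _ _ _ _ z _ hc _ jk) -big_split; apply: eq_bigr => i _ /=.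
  by rewrite linearZ /= -mulrDr -linearD /r [_ + (_ - _)]addrC subrK.
rewrite (horner_coef_wide 1 sQ) mulr_suml.
under eq_bigr => j _ do rewrite expr1n mulr1 (hw j) mulrDr mulr_sumr.
rewrite big_split /=; congr +%R.
under eq_bigr => j _ do rewrite exp_sumM linear_sum mulr_sumr.
rewrite exchange_big; apply: eq_bigr => m _ /=.
rewrite (horner_coef_wide _ sQ) mulr_sumr; apply: eq_bigr => j _.
by rewrite linearZ /= exprD /GRing.scale /=; ring.
Qed.


(** The node 1 comes first because the normalization prescribes P(1) = 1 there; [mu m] thus has
    index m+1, written [lift ord0 m] below. *)
Definition nodes (mu : nat -> K) j : K := if j is j'.+1 then mu j' else 1.

Definition coef_norm k (Q : {poly K}) : K := \sum_(i < k) `|Q`_i|.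

Lemma coef_norm_ge0 k (Q : {poly K}) : 0 <= coef_norm k Q.
Proof. by apply: sumr_ge0. Qed.

Lemma normr_horner_le k (Q : {poly K}) z :
  `|z| <= 1 -> (size Q <= k)%N -> `|Q.[z]| <= coef_norm k Q.
Proof.
move=> z1 sQ; rewrite (horner_coef_wide _ sQ).
apply: le_trans (ler_norm_sum _ _ _) _; apply: ler_sum => i _.
by rewrite normrM normrX ler_piMr // exprn_ile1.
Qed.

Lemma size_shanks_poly k (c : {ffun 'I_k.+1 -> K}) :
  (size (shanks_poly k c) <= k.+1)%N.
Proof. exact: size_poly. Qed.

Lemma coef_norm_shanks_poly k (c : {ffun 'I_k.+1 -> K}) :
  coef_norm k.+1 (shanks_poly k c) = \sum_i `|c i|.
Proof. by apply: eq_bigr => i _; rewrite coef_shanks_poly. Qed.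

Lemma horner_shanks_poly1 y S k n (c : {ffun 'I_k.+1 -> K}) :
  shanks_system y S n c -> (shanks_poly k c).[1] = 1.
Proof.
move=> [h _]; rewrite horner_shanks_poly -[RHS]h.
by apply: eq_bigr => i _; rewrite expr1n mulr1.
Qed.

(** This is [shanks_moment] with Q = [l i], which vanishes at every node but the i-th. The point
    [mu k] is not among the k+1 nodes, so its term survives for every i. *)
Lemma shanks_lagrange_moment y S k n (z : E) (a mu : nat -> K) (u : nat -> E)
    (c : {ffun 'I_k.+1 -> K}) (l : 'I_k.+1 -> {poly K}) (d : K) :
  (forall i, (size (l i) <= k.+1)%N) ->
  (forall i j : 'I_k.+1, (l i).[nodes mu j] = (i == j)%:R) ->
  shanks_system y S n c ->
  (forall n', (n <= n')%N ->
     `|y (S n' - z - exp_sum a mu u k.+1 n')| <= d) ->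
  forall i,
  `|(i == ord0)%:R * y (\sum_i c i *: (S (n + i)%N - z))
    - (\sum_(m < k) (i == lift ord0 m)%:R *
         (a m * y (u m) * mu m ^+ n * (shanks_poly k c).[mu m])
       + a k * y (u k) * mu k ^+ n * (shanks_poly k c).[mu k] * (l i).[mu k])|
  <= coef_norm k.+1 (l i) * coef_norm k.+1 (shanks_poly k c) * d.
Proof.
move=> sl hl hc hd i.
rewrite -(hl i ord0) /= (shanks_moment _ _ _ _ _ a mu u _ _ hc (sl i)).
rewrite big_ord_recr /=.
rewrite [in X in X + _ + _ - _](_ : \sum_(m < k) _ = \sum_(m < k) (i == lift ord0 m)%:R *
         (a m * y (u m) * mu m ^+ n * (shanks_poly k c).[mu m])); last first.
  by apply: eq_bigr => m _; rewrite mulrC -(hl i (lift ord0 m)).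
rewrite addrC addKr; apply: le_trans (ler_norm_sum _ _ _) _.
rewrite /coef_norm -mulrA mulr_suml; apply: ler_sum => j _.
rewrite -mulr_sumr normrM ler_wpM2l //; apply: le_trans (ler_norm_sum _ _ _) _.
rewrite mulr_suml; apply: ler_sum => i' _; rewrite normrM coef_shanks_poly.
by rewrite ler_wpM2l // hd // -addnA leq_addr.
Qed.

Lemma coef_norm_lagrange k (mu : nat -> K) (l : 'I_k.+1 -> {poly K}) P :
  P = \sum_(i < k.+1) P.[nodes mu i] *: l i ->
  coef_norm k.+1 P <= \sum_(i < k.+1) `|P.[nodes mu i]| * coef_norm k.+1 (l i).
Proof.
move=> hP; rewrite {1}hP /coef_norm; under [leRHS]eq_bigr do rewrite mulr_sumr.
rewrite [leRHS]exchange_big; apply: ler_sum => j _ /=; rewrite coef_sum.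
apply: le_trans (ler_norm_sum _ _ _) _; apply: ler_sum => i _.
by rewrite coefZ normrM.
Qed.

End ShanksSystem.

Arguments shanks_poly {K}.
Arguments nodes {K}.
Arguments coef_norm {K}.

(** * Two-sided error bounds for nodes of strictly decreasing modulus, of either sign *)

Section ShanksAsymptotics.
Variables (R : realType) (K : numFieldType) (E : normedModType K).
Variables (y : {linear E -> K^o}) (S : nat -> E) (z : E).
Variables (a mu : nat -> K) (u : nat -> E) (k : nat).
Variable c : nat -> {ffun 'I_k.+1 -> K}.
Hypothesis hK : real_or_complex R K.
Hypothesis hy : continuous y.
Hypothesis mu1 : `|mu 0%N| < 1.
Hypothesis mu_decr : forall i, `|mu i.+1| < `|mu i|.
Hypothesis mu_neq0 : forall i, mu i != 0.
Hypothesis expansion : forall eps, 0 < eps -> \forall n \near \oo,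
  `|S n - z - exp_sum a mu u k.+1 n| <= eps * `|mu k| ^+ n.
Hypothesis hb : forall m, (m < k)%N -> a m * y (u m) != 0.
Hypothesis hc : \forall n \near \oo, shanks_system y S n (c n).

Local Notation b m := (a m * y (u m)).
Local Notation P n := (shanks_poly k (c n)).
Local Notation M n := (coef_norm k.+1 (P n)).
Local Notation error n := (\sum_i c n i *: (S (n + i)%N - z)).

Lemma normr_mu_lt m1 m2 : (m1 < m2)%N -> `|mu m2| < `|mu m1|.
Proof.
elim: m2 => // m2 IH; rewrite ltnS leq_eqVlt => /predU1P[->//|/IH].
exact: lt_trans.
Qed.

Lemma normr_mu_lt1 m : `|mu m| < 1.
Proof. by case: m => // m; apply: lt_trans (normr_mu_lt 0%N _ _) mu1. Qed.

Lemma normr_mu_le1 m : `|mu m| <= 1.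
Proof. exact/ltW/normr_mu_lt1. Qed.

Lemma mu_inj : injective mu.
Proof.
move=> i j ij; case: (ltngtP i j) => // /normr_mu_lt; first by rewrite ij ltxx.
by rewrite ij ltxx.
Qed.

Lemma nodes_inj : injective (nodes mu).
Proof.
have mu_neq1 m : mu m <> 1.
  by move=> m1; have := normr_mu_lt1 m; rewrite m1 normr1 ltxx.
by move=> [|i] [|j] //= => [/esym/mu_neq1|/mu_neq1|/mu_inj->].
Qed.

Lemma mu_pow_gt0 m n : 0 < `|mu m| ^+ n.
Proof. by rewrite exprn_gt0 // normr_gt0. Qed.

Lemma mu_pow_ge0 m n : 0 <= `|mu m| ^+ n.
Proof. exact/ltW/mu_pow_gt0. Qed.

Lemma y_bounded : exists2 C, 0 < C & forall v, `|y v| <= C * `|v|.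
Proof.
have /linear_boundedP := continuous_linear_bounded 0 (hy 0).
move=> [C [Creal hC]]; exists (`|C| + 1); first by rewrite ltr_wpDl.
by apply: hC; rewrite (le_lt_trans (real_ler_norm Creal)) // ltrDl.
Qed.

(** The moment identity at n involves indices up to n + 2k, hence the uniformity in n'. It holds
    because [|mu k| ^+ n'] is nonincreasing in n'. *)
Lemma near_remainder eps : 0 < eps -> \forall n \near \oo, forall n', (n <= n')%N ->
  `|S n' - z - exp_sum a mu u k.+1 n'| <= eps * `|mu k| ^+ n.
Proof.
move=> eps0; have [N _ hN] := expansion _ eps0.
exists N => // n /= Nn n' nn'; apply: le_trans (hN n' _) _ => /=.
  exact: leq_trans nn'.
by rewrite ler_wpM2l ?(ltW eps0) // ler_wiXn2l // normr_mu_le1.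
Qed.

Lemma near_y_remainder eps : 0 < eps -> \forall n \near \oo, forall n', (n <= n')%N ->
  `|y (S n' - z - exp_sum a mu u k.+1 n')| <= eps * `|mu k| ^+ n.
Proof.
move=> eps0; have [C C0 hC] := y_bounded.
have := near_remainder (eps / C) (divr_gt0 eps0 C0).
apply: filterS => n hn n' nn'; apply: le_trans (hC _) _.
by rewrite mulrC -ler_pdivlMr // mulrAC hn.
Qed.

Lemma near_ratio_le eps : 0 < eps -> \forall n \near \oo, forall m : 'I_k,
  `|mu k| ^+ n <= eps * `|mu m| ^+ n.
Proof.
move=> eps0; apply: filter_forall => m.
have m0 : 0 < `|mu m| by rewrite normr_gt0.
have := near_expr_le R K (`|mu k| / `|mu m|) eps hK.
rewrite divr_ge0 // ltr_pdivrMr // mul1r normr_mu_lt // => /(_ isT isT eps0).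
by apply: filterS => n; rewrite expr_div_n ler_pdivrMr // mu_pow_gt0.
Qed.

(* Testing the moment identity against the Lagrange polynomial of the node
   [mu m] isolates [P n].[mu m], up to a multiple of the coefficient norm of
   [P n]; interpolating [P n] at the nodes then bounds this norm itself. *)
Lemma shanks_poly_bounded : exists2 C, 0 < C & \forall n \near \oo,
  M n <= C /\
  forall m : 'I_k.+1, `|mu m| ^+ n * `|(P n).[mu m]| <= C * `|mu k| ^+ n.
Proof.
have [l [sl hl lgen]] := lagrange_basis K k (nodes mu) nodes_inj.
pose B := 1 + \sum_i coef_norm k.+1 (l i).
have lB i : coef_norm k.+1 (l i) <= B.
  rewrite /B (bigD1 i) //= addrCA lerDl addr_ge0 //.
  by apply: sumr_ge0 => j _; exact: coef_norm_ge0.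
have B0 : 0 < B.
  by apply: ltr_wpDr => //; apply: sumr_ge0 => j _; exact: coef_norm_ge0.
(* In [D], [|b k|] accounts for the surviving term at [mu k] and 1 for the remainder; the sum of
   inverses serves as a bound on [|b m|^-1] uniform in m. *)
pose D := (`|b k| + 1) * B * (\sum_(m < k) `|b m|^-1).
have Bge0 := ltW B0.
have sum0 : 0 <= \sum_(m < k) `|b m|^-1.
  by apply: sumr_ge0 => m _; rewrite invr_ge0.
have D0 : 0 <= D by rewrite mulr_ge0 // mulr_ge0 // addr_ge0.
pose T := B * (k%:R * D).
have T0 : 0 <= T by rewrite mulr_ge0 // mulr_ge0.
have T1 : 0 < T + 1 by rewrite ltr_wpDl.
(* [2 * B] will bound [M n], which covers m = k; [2 * B * D] covers m < k through [hD]. *)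
exists (2 * B + 2 * B * D); first 
  by rewrite ltr_wpDr // ?mulr_gt0 // mulr_ge0 // mulr_ge0.
(* With this ratio, interpolation will give M <= B + T M / (2 (T + 1)) <= B + M / 2, and the last
   term can be absorbed on the left. *)
have e0 : 0 < (2 * (T + 1))^-1 by rewrite invr_gt0 mulr_gt0.
near=> n.
have hcn : shanks_system y S n (c n) by near: n.
have hr : forall n', (n <= n')%N ->
    `|y (S n' - z - exp_sum a mu u k.+1 n')| <= 1 * `|mu k| ^+ n.
  by near: n; apply: near_y_remainder.
have hrat : forall m : 'I_k, `|mu k| ^+ n <= (2 * (T + 1))^-1 * `|mu m| ^+ n.
  by near: n; apply: near_ratio_le.
have hP m : `|(P n).[mu m]| <= M n.
  by rewrite normr_horner_le ?normr_mu_le1 // size_shanks_poly.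
have M0 : 0 <= M n by exact: coef_norm_ge0.
have hD (m : 'I_k) : `|mu m| ^+ n * `|(P n).[mu m]| <= D * M n * `|mu k| ^+ n.
  have := shanks_lagrange_moment _ _ _ _ _ _ z a mu u _ l _ sl hl hcn hr
    (lift ord0 m).
  rewrite mul0r sub0r normrN mul1r (bigD1 m) //= eqxx mul1r big1 ?addr0; last first.
    move=> j jm; rewrite (inj_eq lift_inj) eq_sym (negbTE jm) mul0r //.
  move=> h.
  have {}h : `|b m| * (`|mu m| ^+ n * `|(P n).[mu m]|)
      <= (`|b k| + 1) * B * M n * `|mu k| ^+ n.
    rewrite mulrA -normrX -!normrM.
    rewrite -[X in `|X|](addrK
      (b k * mu k ^+ n * (P n).[mu k] * (l (lift ord0 m)).[mu k])).
    apply: le_trans (ler_normB _ _) _.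
    apply: le_trans (lerD h (lexx _)) _.
    rewrite [leRHS](_ : _ = B * M n * `|mu k| ^+ n + `|b k| * `|mu k| ^+ n * M n * B);
      last by ring.
    apply: lerD.
      by rewrite ler_wpM2r ?mu_pow_ge0 // ler_wpM2r.
    rewrite 3!normrM normrX; apply: ler_pM => //.
      by rewrite ler_wpM2l.
    apply: le_trans (lB (lift ord0 m)).
    by rewrite normr_horner_le ?normr_mu_le1.
  have bm0 : 0 < `|b m| by rewrite normr_gt0 hb.
  move: h; rewrite mulrC -ler_pdivlMr // => /le_trans; apply.
  rewrite [leLHS](_ : _ = (`|b k| + 1) * B * M n * `|mu k| ^+ n * `|b m|^-1) //.
  rewrite [leRHS](_ : _ = (`|b k| + 1) * B * M n * `|mu k| ^+ n * \sum_(m < k) `|b m|^-1);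
    last by rewrite /D; ring.
  rewrite ler_wpM2l //.
    by rewrite mulr_ge0 ?mu_pow_ge0 // mulr_ge0 // mulr_ge0 // addr_ge0.
  by rewrite (bigD1 m) //= lerDl; apply: sumr_ge0 => j _; rewrite invr_ge0.
have hM : M n <= 2 * B.
  have hPm (m : 'I_k) : `|(P n).[mu m]| <= D * M n * (2 * (T + 1))^-1.
    rewrite -(ler_pM2l (mu_pow_gt0 m n)); apply: le_trans (hD m) _.
    rewrite mulrCA; apply: le_trans (ler_wpM2l _ (hrat m)) _; first by rewrite mulr_ge0.
    by rewrite [_ * `|mu m| ^+ n]mulrC mulrCA lexx.
  have : M n <= B + T * (M n * (2 * (T + 1))^-1).
    apply: le_trans (coef_norm_lagrange _ _ mu l _ (lgen _ (size_shanks_poly _ _ _))) _.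
    apply: (@le_trans _ _ (\sum_(i < k.+1) `|(P n).[nodes mu i]| * B)).
      by apply: ler_sum => i _; rewrite ler_wpM2l.
    rewrite -mulr_suml big_ord_recl /= (horner_shanks_poly1 _ _ _ _ _ _ _ hcn) normr1.
    rewrite mulrC mulrDr mulr1 lerD2l /T -mulrA ler_pM2l //.
    apply: (@le_trans _ _ (\sum_(i < k) D * M n * (2 * (T + 1))^-1)).
      by apply: ler_sum => i _; exact: hPm.
    by rewrite sumr_const card_ord -[_ *+ k]mulr_natl -/T !mulrA.
  have : T * (M n * (2 * (T + 1))^-1) <= M n / 2.
    rewrite mulrCA ler_wpM2l // invfM mulrCA -[leRHS]mulr1 ler_wpM2l ?invr_ge0 //.
    by rewrite ler_pdivrMr // mul1r lerDl.
  move=> h1 h2; have := le_trans h2 (lerD (lexx B) h1).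
  rewrite -lerBlDr [X in X - _](splitr (M n)) addrK ler_pdivrMr //.
  by rewrite mulrC.
have hMC : M n <= 2 * B + 2 * B * D.
  by apply: le_trans hM _; rewrite lerDl !mulr_ge0.
split=> // m; have [mk|] := ltnP m k.
  apply: le_trans (hD (Ordinal mk)) _; rewrite ler_wpM2r ?mu_pow_ge0 //.
  apply: (@le_trans _ _ (2 * B * D)); first by rewrite mulrC ler_wpM2r.
  by rewrite lerDr mulr_ge0.
move=> km; have -> : m = k :> nat by apply/eqP; rewrite eqn_leq km -ltnS ltn_ord.
by rewrite mulrC ler_wpM2r ?mu_pow_ge0 // (le_trans (hP k)).
Unshelve. all: by end_near. Qed.

(** The m-th term of the expansion contributes a_m mu_m^n P_n(mu_m) u_m, which [shanks_poly_bounded]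
    makes O(mu_k^n); the remainder is at most [M n] times [|mu k| ^+ n]. *)
Lemma shanks_error_le : exists2 C, 0 < C & \forall n \near \oo,
  `|error n| <= C * `|mu k| ^+ n.
Proof.
have [C C0 hC] := shanks_poly_bounded.
exists ((\sum_(m < k.+1) `|a m| * `|u m|) * C + C).
  apply: ltr_wpDl => //; apply: mulr_ge0 (ltW C0).
  by apply: sumr_ge0 => m _; rewrite mulr_ge0.
near=> n.
have [hM hP] : M n <= C /\
  forall m : 'I_k.+1, `|mu m| ^+ n * `|(P n).[mu m]| <= C * `|mu k| ^+ n.
  by near: n.
have hr : forall n', (n <= n')%N ->
    `|S n' - z - exp_sum a mu u k.+1 n'| <= 1 * `|mu k| ^+ n.
  by near: n; apply: near_remainder.
have -> : error n = \sum_i c n i *: exp_sum a mu u k.+1 (n + i)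
    + \sum_i c n i *: (S (n + i)%N - z - exp_sum a mu u k.+1 (n + i)).
  rewrite -big_split; apply: eq_bigr => i _ /=.
  by rewrite -scalerDr [_ + (_ - _)]addrC subrK.
rewrite exp_sumM mulrDl; apply: le_trans (ler_normD _ _) _; apply: lerD.
  apply: le_trans (ler_norm_sum _ _ _) _; rewrite -mulrA mulr_suml.
  apply: ler_sum => m _; rewrite normrZ !normrM normrX.
  rewrite [leLHS](_ : _ = `|a m| * `|u m| * (`|mu m| ^+ n * `|(P n).[mu m]|));
    last by ring.
  by rewrite ler_wpM2l // mulr_ge0.
apply: le_trans (ler_norm_sum _ _ _) _.
apply: (@le_trans _ _ (\sum_i `|c n i| * `|mu k| ^+ n)).
  apply: ler_sum => i _; rewrite normrZ ler_wpM2l //.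
  by rewrite -[leRHS]mul1r hr // leq_addr.
by rewrite -mulr_suml ler_wpM2r ?mu_pow_ge0 // -coef_norm_shanks_poly.
Unshelve. all: by end_near. Qed.

(* [y (error n)] is equivalent to [b k * L ^+ 2 * mu k ^+ n], where [L] is the
   value at [mu k] of the Lagrange polynomial of the node 1. *)
Lemma shanks_error_ge : b k != 0 -> exists2 C, 0 < C & \forall n \near \oo,
  C * `|mu k| ^+ n <= `|error n|.
Proof.
move=> bk0.
have [l [sl hl lgen]] := lagrange_basis K k (nodes mu) nodes_inj.
have [C C0 hC] := shanks_poly_bounded.
have [Cy Cy0 hCy] := y_bounded.
pose L := (l ord0).[mu k].
have L0 : L != 0.
  (* [l ord0] has degree at most k and vanishes at mu_0, ..., mu_(k-1). A further root mu_k would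
     make it zero, against its value 1 at the node 1. *)
  apply/eqP => Lk0; have l00 : l ord0 = 0.
    apply: (roots_geq_poly_eq0 (rs := map mu (iota 0 k.+1))).
    - apply/allP => _ /mapP[m + ->]; rewrite mem_iota add0n ltnS => /andP[_].
      rewrite leq_eqVlt => /predU1P[->|mk]; first by rewrite /root -/L Lk0.
      by rewrite /root (hl ord0 (lift ord0 (Ordinal mk))).
    - by rewrite map_inj_uniq ?iota_uniq //; exact: mu_inj.
    - by rewrite size_map size_iota.
  have := hl ord0 ord0; rewrite l00 horner0 eqxx => /esym/eqP.
  by rewrite oner_eq0.
have nL0 : 0 < `|L| by rewrite normr_gt0.
have nb0 : 0 < `|b k| by rewrite normr_gt0.
pose B := 1 + \sum_i coef_norm k.+1 (l i).
have lB i : coef_norm k.+1 (l i) <= B.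
  rewrite /B (bigD1 i) //= addrCA lerDl addr_ge0 //.
  by apply: sumr_ge0 => j _; exact: coef_norm_ge0.
have B0 : 0 < B.
  by apply: ltr_wpDr => //; apply: sumr_ge0 => j _; exact: coef_norm_ge0.
(* Once |P_n(mu_k)| >= |L| / 2, the main term of [y (error n)] is at least G |mu_k|^n. Half of [G]
   is given up to the remainder, and [Cy] converts the bound on [y (error n)] into one on
   [error n]. *)
pose G := `|b k| * `|L| * (`|L| / 2).
have G0 : 0 < G by rewrite mulr_gt0 ?divr_gt0 // mulr_gt0.
exists (G / 2 / Cy); first by rewrite !divr_gt0.
(* Chosen so that the nodes other than 1 contribute at most |L| / 2 to P_n(mu_k); [k.+1] in place of
   k keeps the denominator nonzero when k = 0. *)
pose eps := `|L| / 2 / (B * C * k.+1%:R).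
have BC0 : 0 < B * C by rewrite mulr_gt0.
have eps0 : 0 < eps by rewrite divr_gt0 ?divr_gt0 // mulr_gt0.
have epsE : eps * (B * C * k.+1%:R) = `|L| / 2.
  by rewrite divfK // gt_eqF // mulr_gt0.
(* Chosen so that the remainder in the moment identity, at most [B * C * d] times [|mu k| ^+ n],
   uses exactly half of [G]. *)
pose d := G / 2 / (B * C).
have d0 : 0 < d by rewrite divr_gt0 // divr_gt0.
near=> n.
have hcn : shanks_system y S n (c n) by near: n.
have [hM hP] : M n <= C /\
  forall m : 'I_k.+1, `|mu m| ^+ n * `|(P n).[mu m]| <= C * `|mu k| ^+ n.
  by near: n.
have hr : forall n', (n <= n')%N ->
    `|y (S n' - z - exp_sum a mu u k.+1 n')| <= d * `|mu k| ^+ n.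
  by near: n; apply: near_y_remainder.
have hrat : forall m : 'I_k, `|mu k| ^+ n <= eps * `|mu m| ^+ n.
  by near: n; apply: near_ratio_le.
have hPm (m : 'I_k) : `|(P n).[mu m]| <= C * eps.
  rewrite -(ler_pM2l (mu_pow_gt0 m n)).
  apply: le_trans (hP (widen_ord (leqnSn k) m)) _.
  by rewrite [leRHS]mulrCA ler_pM2l // mulrC hrat.
have hPL : `|(P n).[mu k] - L| <= `|L| / 2.
  (* In the interpolation formula for P_n at mu_k, the node 1 contributes exactly L because P_n(1) =
     1. *)
  have -> : (P n).[mu k] - L =
      \sum_(m < k) (P n).[mu m] * (l (lift ord0 m)).[mu k].
    rewrite {1}[P n]lgen ?size_shanks_poly // horner_sum big_ord_recl /=.
    rewrite (horner_shanks_poly1 _ _ _ _ _ _ _ hcn) scale1r addrC addKr.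
    by apply: eq_bigr => m _; rewrite hornerZ.
  apply: le_trans (ler_norm_sum _ _ _) _.
  apply: (@le_trans _ _ (\sum_(m < k) C * eps * B)).
    apply: ler_sum => m _; rewrite normrM ler_pM //.
    by apply: le_trans (lB (lift ord0 m)); rewrite normr_horner_le ?normr_mu_le1.
  rewrite sumr_const card_ord -[_ *+ k]mulr_natr.
  apply: (@le_trans _ _ (C * eps * B * k.+1%:R)).
    rewrite ler_wpM2l ?ler_nat ?leqnSn //.
    exact: mulr_ge0 (mulr_ge0 (ltW C0) (ltW eps0)) (ltW B0).
  by rewrite -epsE [leLHS](_ : _ = eps * (B * C * k.+1%:R)) //; ring.
have hPk : `|L| / 2 <= `|(P n).[mu k]|.
  have := le_trans (lerB_dist L (P n).[mu k])
    (eq_ind_r (fun t => t <= _) hPL (distrC _ _)).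
  by rewrite lerBlDl -lerBlDr {1}[`|L|]splitr addrK.
have hw : G / 2 * `|mu k| ^+ n <= `|y (error n)|.
  have := shanks_lagrange_moment _ _ _ _ _ _ z a mu u _ l _ sl hl hcn hr ord0.
  rewrite mul1r [X in _ - (X + _)]big1 ?add0r => [h|m _]; last by rewrite mul0r.
  have {}h : `|y (error n) - b k * mu k ^+ n * (P n).[mu k] * L| <= G / 2 * `|mu k| ^+ n.
    apply: le_trans h _; apply: (@le_trans _ _ (B * C * (d * `|mu k| ^+ n))).
      rewrite ler_wpM2r //; first by rewrite mulr_ge0 // ltW // mu_pow_gt0.
      by rewrite ler_pM // coef_norm_ge0.
    rewrite mulrA /d [_ * (_ / _)]mulrC divfK // gt_eqF //.
  have hG : G * `|mu k| ^+ n <= `|b k * mu k ^+ n * (P n).[mu k] * L|.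
    rewrite 3!normrM normrX.
    rewrite [leLHS](_ : _ = `|b k| * `|mu k| ^+ n * (`|L| / 2) * `|L|);
      last by rewrite /G; ring.
    by rewrite ler_pM2r // ler_pM2l // mulr_gt0 // mu_pow_gt0.
  rewrite distrC in h.
  have := le_trans (lerB_dist _ _) h; rewrite lerBlDl -lerBlDr => hh.
  apply: le_trans hh; rewrite lerBrDr -mulrDl -splitr //.
by rewrite mulrAC ler_pdivrMr // [leRHS]mulrC; apply: le_trans hw (hCy _).
Unshelve. all: by end_near. Qed.

End ShanksAsymptotics.

(** * Reduction of both kinds of sequence to signed nodes, and the theorem *)

Lemma exp_sum_signed (K : numFieldType) (E : normedModType K)
    (a lam : nat -> K) (u : nat -> E) (s : K) p n :
  s ^+ n *: exp_sum a lam u p n = exp_sum a (fun i => s * lam i) u p n.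
Proof.
rewrite /exp_sum scaler_sumr; apply: eq_bigr => i _.
by rewrite scalerA exprMn mulrCA.
Qed.

Theorem theorem7 (R : realType) (K : numFieldType) (hK : real_or_complex R K)
    (E : normedModType K) (y : {linear E -> K^o}) (hy : continuous y)
    (S : nat -> E) (Slim : E) (a lam : nat -> K) (u : nat -> E)
    (hlam1 : lam 0%N < 1) (hlam_decr : forall i, lam i.+1 < lam i)
    (hlam_gt0 : forall i, 0 < lam i)
    (hS : (forall p, (fun n => S n - Slim - exp_sum a lam u p.+1 n)
                       =o_\oo (fun n => lam p ^+ n : K^o)) \/
          (forall p, (fun n => S n - Slim - (-1) ^+ n *: exp_sum a lam u p.+1 n)
                       =o_\oo (fun n => lam p ^+ n : K^o)))
    (k : nat)
    (hnondeg : forall i, (i <= k)%N -> a i * y (u i) != 0)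
    (hsolv_k : \forall n \near \oo, shanks_solvable y S k n)
    (hsolv_k1 : \forall n \near \oo, shanks_solvable y S k.+1 n)
    (hden : \forall n \near \oo, shanks1 y S k n != Slim) :
  (fun n => shanks1 y S k n - Slim) =O_\oo (fun n => lam k ^+ n : K^o) /\
  (fun n => `|shanks1 y S k.+1 n - Slim| / `|shanks1 y S k n - Slim| : K^o)
    =O_\oo (fun n => (lam k.+1 / lam k) ^+ n : K^o).
Proof.
(* The alternating case is the expansion in the powers of [- lam i]. *)
have [s ns hs] : exists2 s : K, `|s| = 1 & forall p eps, 0 < eps ->
    \forall n \near \oo,
      `|S n - Slim - exp_sum a (fun i => s * lam i) u p.+1 n|
      <= eps * `|s * lam p| ^+ n.
  case: hS => h; [exists 1 | exists (-1)]; rewrite ?normrN ?normr1 // => p eps eps0.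
    have /eqoP/(_ eps eps0) := h p; apply: filterS => n.
    by rewrite -exp_sum_signed expr1n scale1r mul1r -normrX.
  have /eqoP/(_ eps eps0) := h p; apply: filterS => n.
  by rewrite -exp_sum_signed mulN1r normrN -normrX.
pose mu i := s * lam i.
have nmu i : `|mu i| = lam i by rewrite normrM ns mul1r gtr0_norm.
have mu1 : `|mu 0%N| < 1 by rewrite nmu.
have mu_decr i : `|mu i.+1| < `|mu i| by rewrite !nmu.
have mu_neq0 i : mu i != 0 by rewrite -normr_gt0 nmu.
have lamX_gt0 i n : 0 < lam i ^+ n by rewrite exprn_gt0.
have hle p : (forall m, (m < p)%N -> a m * y (u m) != 0) ->
    (\forall n \near \oo, shanks_solvable y S p n) ->
    exists2 C, 0 < C & \forall n \near \oo,
      `|shanks1 y S p n - Slim| <= C * lam p ^+ n.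
  move=> hb hsolv.
  have hc : \forall n \near \oo, shanks_system y S n (shanks_coef y S p n).
    by apply: filterS hsolv => n; exact: shanks_coefP.
  have [C C0 hC] := shanks_error_le R K E y S Slim a mu u p _ hK hy mu1 mu_decr
    mu_neq0 (hs p) hb hc.
  exists C => //; apply: filterS2 hsolv hC => n h.
  by rewrite (shanks1_subE _ _ _ _ _ _ _ h) nmu.
have [C C0 hC] := hle k (fun m mk => hnondeg m (ltnW mk)) hsolv_k.
split.
  apply/eqO_exP; exists C => //; apply: filterS hC => n.
  by rewrite (gtr0_norm (lamX_gt0 k n)).
(* At order k+1 the nondegeneracy condition concerns m < k+1, which is exactly the range of
   [hnondeg]. *)
have [C' C'0 hC'] := hle k.+1 hnondeg hsolv_k1.
have hc : \forall n \near \oo, shanks_system y S n (shanks_coef y S k n).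
  by apply: filterS hsolv_k => n; exact: shanks_coefP.
have [D D0 hD] := shanks_error_ge R K E y S Slim a mu u k _ hK hy mu1 mu_decr
  mu_neq0 (hs k) (fun m mk => hnondeg m (ltnW mk)) hc (hnondeg k (leqnn k)).
(* The upper bound at order k+1 is divided by the lower bound at order k. *)
apply/eqO_exP; exists (C' / D); first exact: divr_gt0.
apply: filterS3 hC' hD hsolv_k => n h1 h2 hsol.
rewrite -(shanks1_subE _ _ _ _ _ _ _ hsol) nmu in h2.
have e0 : 0 < `|shanks1 y S k n - Slim|.
  by apply: lt_le_trans h2; rewrite mulr_gt0.
rewrite (ger0_norm (divr_ge0 _ _)) // expr_div_n.
rewrite (gtr0_norm (divr_gt0 _ _)) // mulf_div; apply: ler_pM => //.
by rewrite lef_pV2 // posrE mulr_gt0.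
Qed.
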